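(* Let $f:\Omega\to\mathbb{R}$ be a continuous potential of product type, $f(x)=\sum_{j=1}^{\infty} f_j(x_j)$, where $f_j:[0,1]\to\mathbb{R}$ are fixed functions and the series converges absolutely for every $x=(x_1,x_2,\dots)\in\Omega=[0,1]^{\mathbb{N}}$. Suppose that the iterated series $\sum_{j=1}^{\infty}\sum_{i>j} f_i(x_j)$ converges (to a finite real number) for every $x=(x_1,x_2,\dots)\in\Omega$. Put $g_i(b)=e^{f_i(b)}$, $h_j(b)=\prod_{i>j} g_i(b)$ for $b\in[0,1]$, and define $$h_f(x)=\prod_{j=1}^{\infty} h_j(x_j)\quad (x\in\Omega),\qquad \lambda_f=\int_0^1\prod_{j=1}^{\infty} g_j(b)\,db .$$ Then $\mathcal{L}_f(h_f)=\lambda_f h_f$.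
   Context: $\Omega=[0,1]^{\mathbb{N}}$ is equipped with the metric $d(x,y)=\sum_{n\ge1}|x_n-y_n|/2^n$, where $x=(x_1,x_2,\dots)$, $y=(y_1,y_2,\dots)$. For a continuous function $f:\Omega\to\mathbb{R}$, the Ruelle operator $\mathcal{L}_f$ is defined by $$\mathcal{L}_f(\varphi)(x)=\int_0^1 e^{f(a,x_1,x_2,\dots)}\,\varphi(a,x_1,x_2,\dots)\,da,$$ where $da$ is Lebesgue measure on $[0,1]$. Iterated sums $\sum_j\sum_{i>j}$ mean: first sum over $i>j$, then over $j$. *)

(* Defs.v *)
From HB Require Import structures.
From mathcomp Require Export all_boot all_order all_algebra.
From mathcomp Require Export all_classical all_reals all_analysis.
Export Order.TTheory GRing.Theory Num.Theory.
Export numFieldNormedType.Exports.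

#[export] Set Implicit Arguments.
#[export] Unset Strict Implicit.
#[export] Unset Printing Implicit Defensive.

#[global] Open Scope classical_set_scope.
#[global] Open Scope ring_scope.

(* Sequences are indexed from 0: the coordinate x_(n+1) of the mathematical text
   is [x n], and likewise for the functions f_j, g_j and h_j. Functions on
   [0,1], resp. on Omega, are represented by total functions on R, resp. on
   nat -> R, of which only the values on [0,1], resp. on Omega, matter. *)

Definition Omega (R : realType) : set (nat -> R) :=
  [set x | forall n, 0 <= x n <= 1].

(* The weight 2^n for n >= 1 becomes 2^(n+1) for n >= 0. *)
Definition dist_Omega (R : realType) (x y : nat -> R) : R :=
  \big[+%R/0]_(0 <= n <oo) (`|x n - y n| / 2 ^+ n.+1).

Definition continuous_Omega (R : realType) (f : (nat -> R) -> R) : Prop :=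
  forall x, Omega x -> forall e : R, 0 < e ->
    exists2 r : R, 0 < r &
      forall y, Omega y -> dist_Omega x y < r -> `|f x - f y| < e.

Definition product_type (R : realType) (f : (nat -> R) -> R)
    (fj : nat -> R -> R) : Prop :=
  forall x, Omega x ->
    cvgn (series (fun j => `|fj j (x j)|)) /\
    series (fun j => fj j (x j)) @ \oo --> f x.

(* Convergence of the series over j of the inner sums over i > j; the inner
   series are themselves required to converge. *)
Definition iterated_series_converges (R : realType) (fj : nat -> R -> R)
    (x : nat -> R) : Prop :=
  (forall j, cvgn (fun n => \sum_(j.+1 <= i < n) fj i (x j))) /\
  cvgn (series (fun j => \big[+%R/0]_(j.+1 <= i <oo) fj i (x j))).

Definition scons (R : realType) (a : R) (x : nat -> R) : nat -> R :=
  fun n => if n is m.+1 then x m else a.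

Definition ruelle (R : realType) (f phi : (nat -> R) -> R) (x : nat -> R) : R :=
  \int[@lebesgue_measure R]_(a in `[0, 1])
    (expR (f (scons a x)) * phi (scons a x)).

Definition g_factor (R : realType) (fj : nat -> R -> R) (i : nat) (b : R) : R :=
  expR (fj i b).

Definition h_factor (R : realType) (fj : nat -> R -> R) (j : nat) (b : R) : R :=
  \big[*%R/1]_(j.+1 <= i <oo) g_factor fj i b.

Definition h_fun (R : realType) (fj : nat -> R -> R) (x : nat -> R) : R :=
  \big[*%R/1]_(0 <= j <oo) h_factor fj j (x j).

Definition lambda (R : realType) (fj : nat -> R -> R) : R :=
  \int[@lebesgue_measure R]_(b in `[0, 1])
    (\big[*%R/1]_(0 <= j <oo) g_factor fj j b).

(* Main.v *)
Require Import Defs.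

(** Write [H_j(b)] for the tail sum of the [f_i(b)], [i > j], so that
    [h_j = exp H_j] and [h_f(x) = exp (sum_j H_j(x_j))].  The tails telescope:
    [H_j = f_(j+1) + H_(j+1)], and [f_0(a) + H_0(a)] is the full sum of the
    [f_j(a)], that is [f(a,a,...)].  Adding the series of [f] and of [log h_f] at
    the point [(a,x)] therefore gives [f(a,a,...) + log h_f(x)]
    ([product_type_telescope]).  The integrand of [L_f(h_f)(x)] is thus the
    integrand [exp (f(a,a,...))] of [lambda_f] times the constant [h_f(x)].
    This constant comes out of the integral because [a |-> f(a,a,...)] is
    continuous, hence its exponential is integrable, on [0,1]: the diagonal map
    into Omega is an isometry ([dist_Omega_cst]). *)

Lemma cvg_sum_recl (R : realType) (u : nat -> R) (m : nat) (l : R) :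
  (\sum_(m.+1 <= i < n) u i) @[n --> \oo] --> l ->
  (\sum_(m <= i < n) u i) @[n --> \oo] --> u m + l.
Proof.
move=> ul; apply: cvg_trans (cvgD (cvg_cst (u m)) ul).
apply: near_eq_cvg; near=> n.
rewrite /= [RHS]big_ltn //.
by near: n; exact: nbhs_infty_gt.
Unshelve. all: by end_near. Qed.

Lemma cvg_series_recl (R : realType) (u : nat -> R) (l : R) :
  series (fun j => u j.+1) @ \oo --> l -> series u @ \oo --> u 0%N + l.
Proof.
move=> ul; rewrite -cvg_shiftS.
have -> : [sequence series u n.+1]_n =
    (fun n => u 0%N + series (fun j => u j.+1) n).
  by apply/funext => n; rewrite /series /= big_nat_recl.
exact: cvgD (cvg_cst _) ul.
Qed.

Lemma lim_prod_expR (R : realType) (u : nat -> R) (m : nat) (l : R) :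
  (\sum_(m <= i < n) u i) @[n --> \oo] --> l ->
  \big[*%R/1]_(m <= i <oo) expR (u i) = expR l.
Proof.
move=> ul; apply: cvg_lim => //.
under eq_fun do rewrite -expR_sum.
exact: continuous_cvg (@continuous_expR R l) ul.
Qed.

Lemma Omega_cst (R : realType) (b : R) : 0 <= b <= 1 -> Omega (fun=> b).
Proof. by move=> b01 n. Qed.

Lemma Omega_scons (R : realType) (a : R) (x : nat -> R) :
  0 <= a <= 1 -> Omega x -> Omega (scons a x).
Proof. by move=> a01 Ox [|n] //=; exact: Ox. Qed.

Lemma dist_Omega_cst (R : realType) (a b : R) :
  dist_Omega (fun=> a) (fun=> b) = `|a - b|.
Proof.
rewrite /dist_Omega; apply: cvg_lim => //.
have := @cvg_geometric_series_half R `|a - b| 0.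
rewrite expr0 divr1; apply: cvg_trans; apply: near_eq_cvg; near=> n.
by rewrite /series /=; apply: eq_bigr => i _; rewrite addn1 natrX.
Unshelve. all: by end_near. Qed.

Lemma continuous_diagonal (R : realType) (f : (nat -> R) -> R) :
  continuous_Omega f -> {within `[0, 1], continuous (fun b : R => f (fun=> b))}.
Proof.
move=> fc; apply/subspace_continuousP => b /=; rewrite in_itv /= => b01.
apply/cvgrPdist_lt => e e0.
have [r r0 fr] := fc _ (Omega_cst b01) _ e0.
rewrite near_withinE; near=> c; rewrite /= in_itv /= => c01.
apply: fr; first exact: Omega_cst.
rewrite dist_Omega_cst.
by near: c; apply: (@cvgr_dist_lt _ _ _ _ _ id).
Unshelve. all: by end_near. Qed.

(** The tail sum [H_j(b)] of the [f_i(b)], [i > j]: the logarithm of [h_j(b)]. *)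
Definition tail_sum (R : realType) (fj : nat -> R -> R) (j : nat) (b : R) : R :=
  \big[+%R/0]_(j.+1 <= i <oo) fj i b.

Section ProductType.
Context {R : realType} {f : (nat -> R) -> R} {fj : nat -> R -> R}.
Hypothesis f_prod : product_type f fj.
Hypothesis f_iter : forall x, Omega x -> iterated_series_converges fj x.

Lemma cvg_tail_sum (j : nat) (b : R) : 0 <= b <= 1 ->
  (\sum_(j.+1 <= i < n) fj i b) @[n --> \oo] --> tail_sum fj j b.
Proof. by move=> /Omega_cst /f_iter[+ _] => /(_ j). Qed.

Lemma cvg_series_tail_sum (x : nat -> R) : Omega x ->
  series (fun j => tail_sum fj j (x j)) @ \oo -->
  limn (series (fun j => tail_sum fj j (x j))).
Proof. by move=> /f_iter[_]. Qed.

Lemma tail_sum_recl (j : nat) (b : R) : 0 <= b <= 1 ->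
  tail_sum fj j b = fj j.+1 b + tail_sum fj j.+1 b.
Proof.
move=> b01; apply: cvg_lim => //.
exact: (cvg_sum_recl (u := fj ^~ b) (cvg_tail_sum b01)).
Qed.

Lemma product_type_cst (b : R) : 0 <= b <= 1 ->
  f (fun=> b) = fj 0 b + tail_sum fj 0 b.
Proof.
move=> b01; have [_ fb] := f_prod (Omega_cst b01).
apply: (cvg_unique _ fb) => //.
exact: (cvg_sum_recl (u := fj ^~ b) (cvg_tail_sum b01)).
Qed.

Lemma h_factor_expR (j : nat) (b : R) : 0 <= b <= 1 ->
  h_factor fj j b = expR (tail_sum fj j b).
Proof.
move=> b01; exact: (lim_prod_expR (u := fj ^~ b) (cvg_tail_sum b01)).
Qed.

Lemma h_fun_expR (x : nat -> R) : Omega x ->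
  h_fun fj x = expR (limn (series (fun j => tail_sum fj j (x j)))).
Proof.
move=> Ox; rewrite -(lim_prod_expR (cvg_series_tail_sum Ox)) /h_fun.
by under eq_fun do under eq_bigr do rewrite (h_factor_expR _ (Ox _)).
Qed.

Lemma prod_g_factor (b : R) : 0 <= b <= 1 ->
  \big[*%R/1]_(0 <= j <oo) g_factor fj j b = expR (f (fun=> b)).
Proof. by move=> /Omega_cst /f_prod[_]; exact: lim_prod_expR. Qed.

Lemma product_type_telescope (a : R) (x : nat -> R) :
  0 <= a <= 1 -> Omega x ->
  f (scons a x) + limn (series (fun j => tail_sum fj j (scons a x j))) =
  f (fun=> a) + limn (series (fun j => tail_sum fj j (x j))).
Proof.
move=> a01 Ox; have Oax := Omega_scons a01 Ox.
have [_ fax] := f_prod Oax.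
(* The general term of the sum of the two series at [(a,x)]; its terms of
   positive index are the [H_j(x_j)]. *)
pose w j := fj j (scons a x j) + tail_sum fj j (scons a x j).
have wl : series w @ \oo --> f (scons a x) +
    limn (series (fun j => tail_sum fj j (scons a x j))).
  apply: cvg_trans (cvgD fax (cvg_series_tail_sum Oax)).
  by apply: near_eq_cvg; near=> n; rewrite /series /= [RHS]big_split.
have wS : (fun j => w j.+1) = (fun j => tail_sum fj j (x j)).
  by apply/funext => j; rewrite /w /= -tail_sum_recl.
apply: (cvg_unique _ wl) => //.
rewrite (product_type_cst a01); apply: cvg_series_recl.
by rewrite wS; exact: cvg_series_tail_sum.
Unshelve. all: by end_near. Qed.

End ProductType.

Theorem proposition1 (R : realType) (f : (nat -> R) -> R) (fj : nat -> R -> R)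
    (f_cont : continuous_Omega f)
    (f_prod : product_type f fj)
    (f_iter : forall x, Omega x -> iterated_series_converges fj x) :
  forall x, Omega x -> ruelle f (h_fun fj) x = lambda fj * h_fun fj x.
Proof.
move=> x Ox; rewrite /ruelle /lambda.
transitivity (\int[@lebesgue_measure R]_(a in `[0, 1])
    (expR (f (fun=> a)) * h_fun fj x)).
  apply: eq_Rintegral => a; rewrite inE /= in_itv /= => a01.
  rewrite (h_fun_expR f_iter (Omega_scons a01 Ox)) (h_fun_expR f_iter Ox).
  by rewrite -!expRD (product_type_telescope f_prod f_iter a01 Ox).
rewrite RintegralZr //=; last first.
  apply: continuous_compact_integrable; first exact: segment_compact.
  move=> b; apply: continuous_comp; last exact: continuous_expR.
  exact: continuous_diagonal.
congr (_ * _); apply: eq_Rintegral => a; rewrite inE /= in_itv /= => a01.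
by rewrite (prod_g_factor f_prod).
Qed.
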